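(* Let $G$ be a simple graph of order $n$ with minimum degree $\delta\ge1$, and let $\sigma_{n-1}$ be its largest Laplacian eigenvalue. Then $$\chi(G)\ge\frac{\sigma_{n-1}}{\sigma_{n-1}-\delta}.$$ Moreover, equality holds if $G$ is a $d$-regular bipartite graph, or if $G$ is a complete $r$-partite graph $K_{s,s,\dots,s}$ (with $r$ parts each of size $s$).
   Context: The Laplacian matrix of $G$ is $L(G)=D(G)-A(G)$ (degree diagonal matrix minus adjacency matrix); $\sigma_{n-1}$ denotes its largest eigenvalue. $\chi(G)$ is the chromatic number of $G$, the minimum number of colors in a proper vertex coloring. *)

(* Defs.v *)
From mathcomp Require Import all_boot all_order all_algebra.

Set Implicit Arguments.
Unset Strict Implicit.
Unset Printing Implicit Defensive.

Import Order.TTheory GRing.Theory Num.Theory.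
Local Open Scope ring_scope.

Record sgraph (n : nat) := SGraph {
  adj :> rel 'I_n;
  adj_sym : symmetric adj;
  adj_irrefl : irreflexive adj
}.

Definition degree n (G : sgraph n) (x : 'I_n) : nat := #|[set y | G x y]|.

(* Every degree is less than n, so the default value n only matters for the
   graph of order 0, to which it gives minimum degree 0. *)
Definition min_degree n (G : sgraph n) : nat :=
  \big[minn/n]_(x < n) degree G x.

Definition adjacency_mx (R : pzRingType) n (G : sgraph n) : 'M[R]_n :=
  \matrix_(i, j) (G i j)%:R.

Definition degree_mx (R : pzRingType) n (G : sgraph n) : 'M[R]_n :=
  diag_mx (\row_i (degree G i)%:R).

Definition laplacian (R : pzRingType) n (G : sgraph n) : 'M[R]_n :=
  degree_mx R G - adjacency_mx R G.

(* [eigenvalue] refers to row eigenvectors; for the symmetric matrix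
   [laplacian R G] these are the transposes of the column eigenvectors. *)
Definition largest_eigenvalue (R : rcfType) n (M : 'M[R]_n) (s : R) : Prop :=
  eigenvalue M s /\ forall mu : R, eigenvalue M mu -> mu <= s.

Definition proper_coloring n (G : sgraph n) k (f : {ffun 'I_n -> 'I_k}) : bool :=
  [forall x, forall y, G x y ==> (f x != f y)].

Definition colorable n (G : sgraph n) (k : nat) : bool :=
  [exists f : {ffun 'I_n -> 'I_k}, proper_coloring G f].

Lemma colorable_ex n (G : sgraph n) : exists k, colorable G k.
Proof.
exists n; apply/existsP; exists [ffun x => x].
apply/forallP => x; apply/forallP => y; apply/implyP => Gxy.
by rewrite !ffunE; apply/eqP => xy; rewrite xy adj_irrefl in Gxy.
Qed.

Definition chromatic_number n (G : sgraph n) : nat := ex_minn (colorable_ex G).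

Definition regular n (G : sgraph n) (d : nat) : Prop :=
  forall x, degree G x = d.

Definition bipartite n (G : sgraph n) : Prop :=
  exists A : {set 'I_n}, forall x y, G x y -> (x \in A) != (y \in A).

(* [part x] is the index of the part that contains the vertex x. *)
Definition complete_multipartite n (G : sgraph n) (r s : nat) : Prop :=
  exists part : 'I_n -> 'I_r,
    (forall c : 'I_r, #|[set x | part x == c]| = s) /\
    (forall x y, G x y = (part x != part y)).

(* Main.v *)
Require Import Defs.
From mathcomp Require Import all_boot all_order all_algebra.
From mathcomp Require Import spectral complex ring lra.

(** Give each color [c] of a proper k-coloring the vector with entry k - 1 on
    the vertices of color [c] and -1 elsewhere. Summed over [c], the Laplacian
    quadratic forms of these vectors give k^2 times the sum of the degrees, as
    no edge is monochromatic, and their squared norms give n k (k - 1). The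
    Rayleigh inequality then yields k delta <= sigma (k - 1), that is,
    sigma / (sigma - delta) <= k. If some k-coloring attains equality, then
    chi = k. For the two families this follows from sigma <= 2 d for d-regular
    graphs (k = 2) and from sigma <= n for all graphs (k = r, n = r s,
    delta = n - s). *)

Set Implicit Arguments.
Unset Strict Implicit.
Unset Printing Implicit Defensive.

Import Order.TTheory GRing.Theory Num.Theory.
Local Open Scope ring_scope.
Local Open Scope sesquilinear_scope.

(** * The Rayleigh inequality for Hermitian and real symmetric matrices *)

Lemma spectral_diag_eigenvalue (C : numClosedFieldType) n (A : 'M[C]_n) i :
  A \is normalmx -> eigenvalue A (spectral_diag A 0 i).
Proof.
move=> /orthomx_spectralP A_eq; have Pu := spectral_unit A.
set P := spectralmx A in A_eq Pu *; set d := spectral_diag A in A_eq *.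
apply/eigenvalueP; exists (row i P).
  by rewrite -row_mul {1}A_eq -mulmxA mulKVmx // row_mul row_diag_mx
    -scalemxAl -rowE.
(* A zero row of [P], times a right inverse, would give a zero row of the identity. *)
apply/eqP => Pi0; move: (row_free_unit P); rewrite Pu => /row_freeP[Q PQ].
move: (congr1 (mulmx^~ Q) Pi0); rewrite -row_mul PQ mul0mx => /rowP /(_ i).
by rewrite !mxE eqxx => /eqP; rewrite oner_eq0.
Qed.

(** In the coordinates [w] of [v] in an orthonormal eigenbasis, the form is the sum of the
    [d_j |w_j|^2], and each [d_j] is a real eigenvalue, hence at most [s]. *)
Lemma hermitian_rayleigh_le (C : numClosedFieldType) n (A : 'M[C]_n) (s : C)
    (v : 'rV[C]_n) :
  A \is hermsymmx -> (forall a, a \is Num.real -> eigenvalue A a -> a <= s) ->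
  (v *m A *m (v ^t Num.conj)) 0 0 <= s * (v *m (v ^t Num.conj)) 0 0.
Proof.
move=> Aherm eig_le; have Anorm := hermitian_normalmx Aherm.
have PU := spectral_unitarymx A; have /orthomx_spectralP A_eq := Anorm.
have d_le i : spectral_diag A 0 i <= s.
  apply: eig_le (spectral_diag_eigenvalue i Anorm).
  exact/mxOverP/hermitian_spectral_diag_real.
set P := spectralmx A in PU A_eq *; set d := spectral_diag A in A_eq d_le *.
pose w := v *m (P ^t Num.conj).
have v_eq : v = w *m P by rewrite /w mulmxKtV.
have vs_eq : v ^t Num.conj = (P ^t Num.conj) *m (w ^t Num.conj).
  by rewrite {1}v_eq trmx_mul map_mxM.
have -> : v *m A *m (v ^t Num.conj) = w *m diag_mx d *m (w ^t Num.conj).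
  rewrite A_eq invmx_unitary // vs_eq /w !mulmxA.
  by rewrite mulmxtVK.
have -> : v *m (v ^t Num.conj) = w *m (w ^t Num.conj).
  by rewrite vs_eq /w mulmxA.
rewrite mul_mx_diag !mxE mulr_sumr ler_sum // => j _.
rewrite !mxE mulrAC -normCK mulrC ler_wpM2r ?exprn_ge0 //.
Qed.

(** Over the complex extension of [R] the matrix becomes Hermitian, and its real eigenvalues are
    already eigenvalues of [M]. *)
Lemma symmetric_rayleigh_le (R : rcfType) n (M : 'M[R]_n) (s : R)
    (v : 'rV[R]_n) :
  M^T = M -> (forall mu, eigenvalue M mu -> mu <= s) ->
  (v *m M *m v^T) 0 0 <= s * (v *m v^T) 0 0.
Proof.
move=> Msym eig_le; pose toC := real_complex R.
have conj_real m (u : 'M[R]_(m, n)) :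
    (map_mx toC u) ^t Num.conj = map_mx toC u^T.
  by apply/matrixP => i j; rewrite !mxE; exact: conjc_real.
have Mherm : map_mx toC M \is hermsymmx.
  by apply/is_hermitianmxP; rewrite expr0 scale1r conj_real Msym.
have Meig a : a \is Num.real -> eigenvalue (map_mx toC M) a -> a <= toC s.
  by move=> /RRe_real <-; rewrite eigenvalue_map lecR => /eig_le.
have := hermitian_rayleigh_le (map_mx toC v) Mherm Meig.
by rewrite conj_real -!map_mxM !mxE -rmorphM lecR.
Qed.

(** * Degrees and the Laplacian quadratic form *)

Lemma degreeE (R : pzSemiRingType) n (G : sgraph n) i :
  (degree G i)%:R = \sum_j (G i j)%:R :> R.
Proof.
rewrite /degree -sum1_card natr_sum big_mkcond /=.
by apply: eq_bigr => j _; rewrite inE; case: (G i j).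
Qed.

Lemma min_degree_le n (G : sgraph n) i : (min_degree G <= degree G i)%N.
Proof.
rewrite /min_degree; elim: (index_enum _) (mem_index_enum i) => //= j s IH.
rewrite inE big_cons => /orP[/eqP <-|/IH le_s]; first exact: geq_minl.
by rewrite geq_min le_s orbT.
Qed.

(** The condition [d <= n] covers the default value [n] of the iterated minimum. *)
Lemma le_min_degree n (G : sgraph n) d :
  (d <= n)%N -> (forall i, (d <= degree G i)%N) -> (d <= min_degree G)%N.
Proof.
move=> dn dG; apply: (big_ind (fun m => (d <= m)%N)) => // a b da db.
by rewrite leq_min da.
Qed.

Lemma min_degree_gt0_order n (G : sgraph n) :
  (0 < min_degree G)%N -> (0 < n)%N.
Proof. by case: n G => // G; rewrite /min_degree big_ord0. Qed.

Lemma laplacian_sym (R : pzRingType) n (G : sgraph n) :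
  (laplacian R G)^T = laplacian R G.
Proof.
apply/matrixP => i j; rewrite !mxE adj_sym eq_sym.
by case: eqVneq => [->|]; rewrite ?mulr0n.
Qed.

Lemma dotrow_sqr (R : comPzRingType) n (v : 'rV[R]_n) :
  (v *m v^T) 0 0 = \sum_i v 0 i ^+ 2.
Proof. by rewrite mxE; apply: eq_bigr => i _; rewrite mxE expr2. Qed.

(** The double sum meets each edge in both orders, whence the factor 2. With [Q] the degree part and
    [B] the adjacency part, the form is [Q - B], and expanding the squares gives [Q - 2 B + Q]. *)
Lemma laplacian_form (R : comPzRingType) n (G : sgraph n) (v : 'rV[R]_n) :
  (v *m laplacian R G *m v^T) 0 0 *+ 2 =
  \sum_i \sum_j (G i j)%:R * (v 0 i - v 0 j) ^+ 2.
Proof.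
pose Q := \sum_i (degree G i)%:R * v 0 i ^+ 2.
pose B := \sum_i \sum_j (G i j)%:R * (v 0 i * v 0 j).
have Q_row : \sum_i \sum_j (G i j)%:R * v 0 i ^+ 2 = Q.
  by apply: eq_bigr => i _; rewrite -mulr_suml -degreeE.
have Q_col : \sum_i \sum_j (G i j)%:R * v 0 j ^+ 2 = Q.
  rewrite exchange_big -Q_row; apply: eq_bigr => i _.
  by apply: eq_bigr => j _; rewrite adj_sym.
have -> : (v *m laplacian R G *m v^T) 0 0 = Q - B.
  rewrite mulmxBr mulmxBl mxE [X in _ + X]mxE mul_mx_diag; congr (_ - _).
    by rewrite mxE; apply: eq_bigr => i _; rewrite !mxE expr2 mulrAC mulrC.
  rewrite mxE [B]exchange_big; apply: eq_bigr => j _ /=.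
  rewrite !mxE mulr_suml; apply: eq_bigr => i _.
  by rewrite !mxE mulrAC mulrC [X in _ * X]mulrC adj_sym.
transitivity (Q - B *+ 2 + Q); first by rewrite mulrnBl mulr2n addrAC.
rewrite -{1}Q_row -Q_col /B -sumrMnl -sumrB -big_split /=.
apply: eq_bigr => i _; rewrite -sumrMnl -sumrB -big_split /=.
by apply: eq_bigr => j _; rewrite sqrrB !mulrDr mulrN mulrnAr.
Qed.

(** * Upper bounds on Laplacian eigenvalues *)

Lemma laplacian_eigenvalue_form (R : realFieldType) n (G : sgraph n) s :
  eigenvalue (laplacian R G) s ->
  exists2 v : 'rV[R]_n, 0 < \sum_i v 0 i ^+ 2 &
    \sum_i \sum_j (G i j)%:R * (v 0 i - v 0 j) ^+ 2
      = s * (\sum_i v 0 i ^+ 2) *+ 2.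
Proof.
move=> /eigenvalueP[v vL v0]; exists v.
  rewrite lt_def sumr_ge0 => [|i _]; last exact: sqr_ge0.
  rewrite andbT; apply: contra v0 => /eqP sum0; apply/eqP/rowP => i.
  rewrite mxE; apply/eqP; rewrite -sqrf_eq0; apply/eqP.
  by apply: (psumr_eq0P _ sum0) => // j _; exact: sqr_ge0.
by rewrite -laplacian_form vL -scalemxAl mxE dotrow_sqr.
Qed.

(** On each edge [(a - b)^2 <= 2 (a^2 + b^2)]; over ordered pairs the right sides add up to [4 d N],
    against [2 s N] for an eigenvector of squared norm [N]. *)
Lemma regular_laplacian_eigenvalue_le (R : realFieldType) n (G : sgraph n) d s :
  regular G d -> eigenvalue (laplacian R G) s -> s <= 2 * d%:R.
Proof.
move=> Gd /laplacian_eigenvalue_form[v].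
set N := \sum_i v 0 i ^+ 2 => N_gt0 formE.
rewrite -(ler_pM2r N_gt0) -(ler_pMn2r (ltn0Sn 1)) -formE.
have row_sum : \sum_i \sum_j (G i j)%:R * v 0 i ^+ 2 = d%:R * N.
  rewrite mulr_sumr; apply: eq_bigr => i _.
  by rewrite -mulr_suml -degreeE Gd.
have col_sum : \sum_i \sum_j (G i j)%:R * v 0 j ^+ 2 = d%:R * N.
  rewrite exchange_big -row_sum; apply: eq_bigr => i _.
  by apply: eq_bigr => j _; rewrite adj_sym.
have -> : 2 * d%:R * N *+ 2 = (d%:R * N + d%:R * N) *+ 2 by ring.
rewrite -{1}row_sum -col_sum -big_split -sumrMnl /= ler_sum // => i _.
rewrite -big_split -sumrMnl ler_sum // => j _ /=.
rewrite -mulrDr -mulrnAr ler_wpM2l // -subr_ge0.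
have -> : (v 0 i ^+ 2 + v 0 j ^+ 2) *+ 2 - (v 0 i - v 0 j) ^+ 2
  = (v 0 i + v 0 j) ^+ 2 by ring.
exact: sqr_ge0.
Qed.

(** Adding the missing edges can only increase the form, and for the complete graph the double sum
    is [2 n N - 2 S^2 <= 2 n N]. *)
Lemma laplacian_eigenvalue_le_order (R : realFieldType) n (G : sgraph n) s :
  eigenvalue (laplacian R G) s -> s <= n%:R.
Proof.
move=> /laplacian_eigenvalue_form[v]; set N := \sum_i v 0 i ^+ 2 => N_gt0 formE.
rewrite -(ler_pM2r N_gt0) -(ler_pMn2r (ltn0Sn 1)) -formE.
pose S := \sum_i v 0 i.
apply: (@le_trans _ _ (\sum_i \sum_j (v 0 i - v 0 j) ^+ 2)).
  apply: ler_sum => i _; apply: ler_sum => j _.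
  by rewrite ler_piMl ?sqr_ge0 // lern1 leq_b1.
have -> : \sum_i \sum_j (v 0 i - v 0 j) ^+ 2 = n%:R * N *+ 2 - S ^+ 2 *+ 2.
  under eq_bigr => i _ do under eq_bigr => j _ do rewrite sqrrB addrAC.
  under eq_bigr => i _.
    rewrite sumrB sumrMnl -mulr_sumr big_split sumr_const card_ord /=.
    over.
  rewrite sumrB sumrMnl -mulr_suml -expr2 big_split /= sumr_const card_ord.
  by rewrite sumrMnl -/N -/S; ring.
by rewrite gerBl mulrn_wge0 // sqr_ge0.
Qed.

(** * Proper colorings and the ratio bound *)

Lemma coloring_laplacian_bound (R : rcfType) n (G : sgraph n) (s : R) k
    (f : {ffun 'I_n -> 'I_k}) :
  (forall mu, eigenvalue (laplacian R G) mu -> mu <= s) ->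
  proper_coloring G f ->
  k%:R ^+ 2 * \sum_i (degree G i)%:R <= s * (n%:R * (k%:R * (k%:R - 1))).
Proof.
move=> eig_le /forallP f_proper.
pose v c : 'rV[R]_n := \row_i (k%:R * (f i == c)%:R - 1).
have ray c : \sum_i \sum_j (G i j)%:R * (v c 0 i - v c 0 j) ^+ 2
    <= s * (\sum_i v c 0 i ^+ 2) *+ 2.
  rewrite -laplacian_form ler_pMn2r // -dotrow_sqr.
  exact: symmetric_rayleigh_le (laplacian_sym R G) eig_le.
have sum_ind i : \sum_c (f i == c)%:R = 1 :> R.
  rewrite (bigD1 (f i)) //= eqxx big1 ?addr0 // => c.
  by rewrite eq_sym => /negbTE ->.
have sqr_ind i c : (f i == c)%:R ^+ 2 = (f i == c)%:R :> R.
  by case: (f i == c); rewrite ?expr1n ?expr0n.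
(* At a vertex, one color gives the entry [k - 1] and the other [k - 1] colors give [-1]. *)
have norm_sum i : \sum_c v c 0 i ^+ 2 = k%:R * (k%:R - 1).
  under eq_bigr => c _ do rewrite mxE sqrrB1 exprMn sqr_ind.
  rewrite big_split /= sumrB sumrMnl -!mulr_sumr !sum_ind sumr_const card_ord.
  by ring.
have diff_sum i j : G i j ->
    \sum_c (v c 0 i - v c 0 j) ^+ 2 = k%:R ^+ 2 *+ 2.
  move=> Gij; have := forallP (f_proper i) j; rewrite Gij /= => f_ij.
  (* The difference is [k] for [c = f i], [-k] for [c = f j], and 0 for other colors; the first two
     cases are disjoint because [f] is proper. *)
  transitivity (\sum_c k%:R ^+ 2 * ((f i == c)%:R + (f j == c)%:R) : R).
    apply: eq_bigr => c _; rewrite !mxE.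
    case: (eqVneq (f i) c) f_ij => [<-|_ _].
      by rewrite eq_sym => /negbTE ->; rewrite mulr1n mulr0n; ring.
    by case: (f j == c); rewrite ?mulr1n ?mulr0n; ring.
  by rewrite -mulr_sumr big_split /= !sum_ind; ring.
rewrite -(ler_pMn2r (ltn0Sn 1)).
(* The Rayleigh inequalities are added over all colors; exchanging the sums brings the color sum
   inside, where [norm_sum] and [diff_sum] evaluate it. *)
have := ler_sum (index_enum 'I_k) (fun c (_ : true) => ray c).
rewrite sumrMnl -mulr_sumr [X in _ * X]exchange_big /=.
under [X in _ * X]eq_bigr => i _ do rewrite norm_sum.
rewrite sumr_const card_ord -[_ *+ n]mulr_natl => sum_ray.
apply: le_trans sum_ray.
rewrite exchange_big mulr_sumr -sumrMnl ler_sum // => i _.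
rewrite exchange_big degreeE mulr_sumr -sumrMnl ler_sum // => j _.
rewrite -mulr_sumr; case: (boolP (G i j)) => [Gij|_].
  by rewrite diff_sum // mulr1 mul1r.
by rewrite mulr0 mul0r mul0rn.
Qed.

Lemma colorable_gt0 n (G : sgraph n) k :
  (0 < n)%N -> colorable G k -> (0 < k)%N.
Proof.
move=> n_gt0 /existsP[f _].
exact: leq_ltn_trans (ltn_ord (f (Ordinal n_gt0))).
Qed.

(** The degree sum is at least [n] times the minimum degree, and the positive factor [n k] then
    cancels. *)
Lemma colorable_min_degree_bound (R : rcfType) n (G : sgraph n) (s : R) k :
  (0 < min_degree G)%N ->
  (forall mu, eigenvalue (laplacian R G) mu -> mu <= s) ->
  colorable G k -> k%:R * (min_degree G)%:R <= s * (k%:R - 1).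
Proof.
move=> d_gt0 eig_le col_k.
have n_gt0 := min_degree_gt0_order d_gt0.
have k_gt0 := colorable_gt0 n_gt0 col_k.
have /existsP[f /(coloring_laplacian_bound eig_le) le_f] := col_k.
have nk_gt0 : 0 < n%:R * k%:R :> R by rewrite mulr_gt0 ?ltr0n.
rewrite -(ler_pM2l nk_gt0).
have -> : n%:R * k%:R * (s * (k%:R - 1)) = s * (n%:R * (k%:R * (k%:R - 1)))
  by ring.
apply: le_trans le_f.
have -> : n%:R * k%:R * (k%:R * (min_degree G)%:R)
  = k%:R ^+ 2 * (n%:R * (min_degree G)%:R) :> R by ring.
have -> : n%:R * (min_degree G)%:R = \sum_(i < n) (min_degree G)%:R :> R.
  by rewrite sumr_const card_ord mulr_natl.
rewrite ler_wpM2l ?sqr_ge0 //.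
by apply: ler_sum => i _; rewrite ler_nat min_degree_le.
Qed.

Lemma colorable_ratio_le (R : rcfType) n (G : sgraph n) (s : R) k :
  (0 < min_degree G)%N ->
  (forall mu, eigenvalue (laplacian R G) mu -> mu <= s) ->
  colorable G k ->
  (min_degree G)%:R < s /\ s / (s - (min_degree G)%:R) <= k%:R.
Proof.
move=> d_gt0 eig_le col_k.
have := colorable_min_degree_bound d_gt0 eig_le col_k.
have := colorable_gt0 (min_degree_gt0_order d_gt0) col_k.
have : 0 < (min_degree G)%:R :> R by rewrite ltr0n.
rewrite -(ler_nat R); set d := (min_degree G)%:R; set x := k%:R.
move=> d_gt0R x_ge1 le_x.
(* For [x = 1] the bound would read [d <= 0]. *)
have x_gt1 : 1 < x.
  rewrite lt_def x_ge1 andbT; apply: contraTneq le_x => ->.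
  by rewrite subrr mulr0 mul1r -ltNge.
have d_lt : d < s.
  have x1_gt0 : 0 < x - 1 by rewrite subr_gt0.
  (* Indeed [d (x - 1) < x d <= s (x - 1)]. *)
  by rewrite -(ltr_pM2r x1_gt0); nra.
split=> //; rewrite ler_pdivrMr ?subr_gt0 //; nra.
Qed.

(** The assumed inequality reverses the general bound, so the ratio equals [k]. The chromatic number
    is at most [k] by minimality, and at least the ratio by the bound for an optimal coloring. *)
Lemma chromatic_number_extremal (R : rcfType) n (G : sgraph n) (s : R) k :
  (0 < min_degree G)%N ->
  (forall mu, eigenvalue (laplacian R G) mu -> mu <= s) ->
  colorable G k -> s * (k%:R - 1) <= k%:R * (min_degree G)%:R ->
  (chromatic_number G)%:R = s / (s - (min_degree G)%:R).
Proof.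
move=> d_gt0 eig_le col_k k_extremal.
have eq_k : s * (k%:R - 1) = k%:R * (min_degree G)%:R.
  by apply/le_anti; rewrite k_extremal (colorable_min_degree_bound d_gt0).
have [d_lt _] := colorable_ratio_le d_gt0 eig_le col_k.
have sd_neq0 : s - (min_degree G)%:R != 0 by rewrite gt_eqF ?subr_gt0.
have k_val : s / (s - (min_degree G)%:R) = k%:R.
  by apply: (canLR (mulfK sd_neq0)); lra.
rewrite /chromatic_number; case: ex_minnP => m col_m m_min.
apply/le_anti; rewrite (colorable_ratio_le d_gt0 eig_le col_m).2 andbT.
by rewrite k_val ler_nat m_min.
Qed.

(** * Colorings, orders and degrees in the two extremal families *)

Lemma bipartite_colorable n (G : sgraph n) : bipartite G -> colorable G 2.
Proof.
move=> [A A_bip]; apply/existsP; exists [ffun x => inord (x \in A)].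
apply/forallP => x; apply/forallP => y; apply/implyP => /A_bip; rewrite !ffunE.
by case: (x \in A); case: (y \in A) => //= _; rewrite -val_eqE /= !inordK.
Qed.

Lemma complete_multipartite_colorable n (G : sgraph n) r s :
  complete_multipartite G r s -> colorable G r.
Proof.
move=> [part [_ GE]]; apply/existsP; exists (finfun part).
apply/forallP => x; apply/forallP => y; apply/implyP.
by rewrite GE !ffunE.
Qed.

Lemma complete_multipartite_order n (G : sgraph n) r s :
  complete_multipartite G r s -> n = (r * s)%N.
Proof.
move=> [part [part_s _]]; rewrite -{1}(card_ord n) -sum1_card.
rewrite (partition_big part xpredT) //=.
transitivity (\sum_(c < r) s)%N; last by rewrite sum_nat_const card_ord.
apply: eq_bigr => c _; rewrite -(part_s c) -sum1_card.
by apply: eq_bigl => x; rewrite inE.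
Qed.

(** The non-neighbors of a vertex, itself included, are exactly its part. *)
Lemma complete_multipartite_degree n (G : sgraph n) r s x :
  complete_multipartite G r s -> degree G x = (n - s)%N.
Proof.
move=> [part [part_s GE]]; rewrite /degree cardsCs card_ord.
rewrite -(part_s (part x)); congr (n - _)%N; apply: eq_card => y.
by rewrite !inE GE negbK eq_sym.
Qed.

Theorem theorem3p5 (R : rcfType) (n : nat) (G : sgraph n) (sigma : R)
  (hdelta : (1 <= min_degree G)%N)
  (hsigma : largest_eigenvalue (laplacian R G) sigma) :
  (chromatic_number G)%:R >= sigma / (sigma - (min_degree G)%:R) /\
  (forall d : nat, regular G d -> bipartite G ->
     (chromatic_number G)%:R = sigma / (sigma - (min_degree G)%:R)) /\
  (forall r s : nat, complete_multipartite G r s ->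
     (chromatic_number G)%:R = sigma / (sigma - (min_degree G)%:R)).
Proof.
have [eig_sigma sigma_max] := hsigma.
have n_gt0 := min_degree_gt0_order hdelta.
have degree_le x : (degree G x <= n)%N by rewrite -[leqRHS]card_ord max_card.
split; [|split=> [d Gd Gbip|r s Grs]].
- rewrite /chromatic_number; case: ex_minnP => m col_m _.
  exact: (colorable_ratio_le hdelta sigma_max col_m).2.
- apply: (chromatic_number_extremal hdelta sigma_max (bipartite_colorable Gbip)).
  have le_d : (d <= min_degree G)%N.
    apply: le_min_degree => [|x]; last by rewrite Gd.
    by rewrite -(Gd (Ordinal n_gt0)).
  (* For [k = 2] the extremal inequality reads [sigma <= 2 * min_degree G]. *)
  have := regular_laplacian_eigenvalue_le Gd eig_sigma.
  move: le_d; rewrite -(ler_nat R); lra.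
- have Gr := complete_multipartite_colorable Grs.
  apply: (chromatic_number_extremal hdelta sigma_max Gr).
  have r_gt0 := colorable_gt0 n_gt0 Gr.
  have nE := complete_multipartite_order Grs.
  have le_s : (s <= n)%N by rewrite nE leq_pmull.
  have : (n - s <= min_degree G)%N.
    apply: le_min_degree => [|x]; first exact: leq_subr.
    by rewrite (complete_multipartite_degree x Grs).
  move: r_gt0; rewrite -!(ler_nat R) natrB // => r_ge1 le_d.
  (* Since [n = r s], one has [sigma (r - 1) <= n (r - 1) = r (n - s)], and [n - s] is at most the
     minimum degree. *)
  have le_sigma := laplacian_eigenvalue_le_order eig_sigma.
  have nER : n%:R = r%:R * s%:R :> R by rewrite {1}nE natrM.
  nra.
Qed.
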